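(* Consider the geometric amoebot model with reconfigurable circuits. There exists a protocol, using only the global circuit, such that on every connected amoebot structure of $n$ amoebots the amoebots elect a leader (i.e. they agree on exactly one single amoebot, which becomes the leader) within $\Theta(\log n)$ rounds, with high probability.
   Context: Amoebot model with circuits. $G_{eqt}=(V,E)$ is the infinite regular triangular grid graph. A set of $n$ amoebots occupies a finite set $S\subseteq V$ of nodes, $|S|=n$, exactly one amoebot per node of $S$; the induced graph $G_S=G_{eqt}|_S$ is connected; amoebots do not move. Amoebots on adjacent nodes are neighbors and are joined by a bond. All amoebots are anonymous and run the same randomized finite state machine (constant memory, independent of $n$). Each amoebot assigns locally unique labels to its incident edges; amoebots need not agree on a compass orientation (which of the six directions is ''north'') nor on a chirality (which sense of rotation is clockwise). Every edge incident to an amoebot carries the same constant number of pins (for this theorem any number $\ge 1$) in a fixed linear order; the pins on a bond are shared by the two neighbors. Each amoebot chooses a pin configuration: an arbitrary set of undirected wires between pins on its own incident edges. If $P$ is the set of all pins and $C$ the set of all wires, a circuit is a connected component of the graph $(P,C)$; an amoebot is part of a circuit iff the circuit contains a pin on one of its bonds. Time proceeds in synchronous rounds; in each round every amoebot executes a look-compute-act cycle: it reads its memory and the beeps received on its circuits, computes and updates its memory, and then may reconfigure its wires and send a beep on any of its circuits. A beep sent on a circuit is received in the next round by all amoebots of that circuit; an amoebot only learns whether at least one beep was sent on the circuit, not the origin nor the number of senders. Running time is the number of rounds. Global circuit: the circuit obtained when every amoebot connects all of its pins together; it contains all amoebots. With high probability (w.h.p.): with probability at least $1-1/n^c$ where the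 constant $c$ can be made arbitrarily large (by choosing constants of the protocol and in the asymptotic notation). *)

(* Defs.v *)
From mathcomp Require Import all_boot all_order all_fingroup all_algebra finmap.
From mathcomp Require Import reals exp.

Set Implicit Arguments.
Unset Strict Implicit.
Unset Printing Implicit Defensive.

Import Order.TTheory GRing.Theory Num.Theory.
Local Open Scope fset_scope.
Local Open Scope ring_scope.

(* The infinite triangular grid in axial coordinates: the six directions, in
   cyclic order, are the unit vectors at multiples of 60 degrees. *)
Notation node := (int * int)%type.

Definition offset (d : 'I_6) : node :=
  nth (0, 0) [:: (1, 0); (0, 1); (-1, 1); (-1, 0); (0, -1); (1, -1)] d.

Definition nbr (v : node) (d : 'I_6) : node := v + offset d.

Definition adjacent (u v : node) : bool := [exists d, nbr u d == v].

Definition connected_structure (S : {fset node}) : Prop :=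
  S != fset0 /\
  forall u v : S, connect (fun x y : S => adjacent (val x) (val y)) u v.

(* A pin is an edge, given by its set of endpoints, and a position in the
   linear order of the k pins of that edge; hence the pins of a bond are
   literally the same objects for both of its endpoints. *)
Notation pin k := ({fset node} * 'I_k)%type.

Definition edge_pin k (v : node) (d : 'I_6) (j : 'I_k) : pin k :=
  ([fset v; nbr v d], j).

Definition all_pins k (S : {fset node}) : {fset pin k} :=
  [fset edge_pin (val x.1) x.2.1 x.2.2 | x : S * ('I_6 * 'I_k)].

(* A pin as seen by an amoebot: its own label of the edge and the position on
   that edge. *)
Notation lpin k := ('I_6 * 'I_k)%type.

(* lab v l is the actual direction of the edge that v labels l.  Every
   bijection is allowed, which covers in particular every choice of compass
   orientation and chirality. *)
Definition labelling (S : {fset node}) : Type := S -> {perm 'I_6}.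

Definition pin_of k (S : {fset node}) (lab : labelling S) (v : S)
    (p : lpin k) : pin k := edge_pin (val v) (lab v p.1) p.2.

(* Wires are stored as pairs but are undirected: every use symmetrizes. *)
Notation pinconf k := {set (lpin k * lpin k)}.

Definition joins_all k (c : pinconf k) : Prop :=
  forall p q : lpin k,
    connect (fun x y => ((x, y) \in c) || ((y, x) \in c)) p q.

Record fdist (R : realType) (T : finType) := FDist {
  pmf :> T -> R;
  pmf_ge0 : forall x, 0 <= pmf x;
  pmf_sum1 : \sum_x pmf x = 1
}.

Inductive role := Undecided | Leader | NonLeader.

Definition is_decided (r : role) : bool :=
  if r is Undecided then false else true.
Definition is_leader (r : role) : bool := if r is Leader then true else false.

(* What an amoebot ends a round with: its memory, the wires it has set up, and
   the local pins on whose circuits it beeps. *)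
Notation outcome M k := (M * (pinconf k * {set (lpin k)}))%type.

(* The anonymous randomized finite state machine run by every amoebot.  The set
   argument of [trans] consists of the local pins on whose circuits a beep is
   received in the current round. *)
Record protocol (R : realType) (k : nat) := Protocol {
  memory : finType;
  init_memory : memory;
  trans : memory -> {set (lpin k)} -> fdist R (outcome memory k);
  output : memory -> role
}.

Definition global_circuit_only R k (A : protocol R k) : Prop :=
  forall q B (x : outcome (memory A) k), 0 < trans q B x -> joins_all x.2.1.

Definition irrevocable R k (A : protocol R k) : Prop :=
  forall q B (x : outcome (memory A) k),
    0 < trans q B x -> output q <> Undecided -> output x.1 = output q.

Section Execution.
Variables (R : realType) (k : nat) (A : protocol R k).
Variables (S : {fset node}) (lab : labelling S).

Notation config := {ffun S -> outcome (memory A) k}.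

Definition init_config : config := [ffun=> (init_memory A, (set0, set0))].

Definition wired (g : config) (p q : all_pins k S) : bool :=
  [exists v : S, exists w in (g v).2.1,
     let: (x, y) := (pin_of lab v w.1, pin_of lab v w.2) in
     ((x == val p) && (y == val q)) || ((x == val q) && (y == val p))].

Definition circuit (g : config) (p : all_pins k S) : {set all_pins k S} :=
  [set q | connect (wired g) p q].

(* The circuit contains a pin on a bond of v, i.e. on an edge leading to an
   occupied node. *)
Definition part_of (v : S) (C : {set all_pins k S}) : bool :=
  [exists d : 'I_6, exists j : 'I_k, (nbr (val v) d \in S) &&
     [exists q in C, val q == edge_pin (val v) d j]].

Definition beeps_on (g : config) (u : S) (C : {set all_pins k S}) : bool :=
  part_of u C && [exists p in (g u).2.2, exists q in C, val q == pin_of lab u p].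

Definition received (g : config) (v : S) : {set (lpin k)} :=
  [set l | [exists p : all_pins k S,
     [&& val p == pin_of lab v l, part_of v (circuit g p) &
         [exists u : S, beeps_on g u (circuit g p)]]]].

(* One synchronous round; the amoebots' coins are independent. *)
Definition round_prob (g g' : config) : R :=
  \prod_(v : S) trans (g v).1 (received g v) (g' v).

(* The first N rounds of an execution are given by the configurations after
   rounds 1, ..., N. *)
Definition config_at N (w : N.-tuple config) (t : nat) : config :=
  nth init_config (init_config :: w) t.

Definition run_prob N (w : N.-tuple config) : R :=
  \prod_(t < N) round_prob (config_at w t) (config_at w t.+1).

Definition prob N (E : pred (N.-tuple config)) : R :=
  \sum_(w : N.-tuple config | E w) run_prob w.

Definition terminated (g : config) : bool :=
  [forall v : S, is_decided (output (g v).1)].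

Definition leader_elected (g : config) : bool :=
  terminated g && (#|[set v : S | is_leader (output (g v).1)]| == 1%N).

(* The running time, i.e. the first round after which all amoebots are decided,
   lies in [lo, hi], and at that time exactly one amoebot is the leader.  This
   event does not depend on N once hi <= N. *)
Definition elects_within (lo hi : R) N (w : N.-tuple config) : bool :=
  [exists t : 'I_N.+1,
     [&& lo <= t%:R <= hi, leader_elected (config_at w t) &
         [forall s : 'I_N.+1, (s < t)%N ==> ~~ terminated (config_at w s)]]].

End Execution.

(* Main.v *)
Require Import Defs.
From mathcomp Require Import all_boot all_order all_algebra finmap.
From mathcomp Require Import reals exp.
From mathcomp Require Import all_fingroup ring lra.

Import Order.TTheory GRing.Theory Num.Theory.
Local Open Scope fset_scope.
Local Open Scope ring_scope.

Set Implicit Arguments.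
Unset Strict Implicit.
Unset Printing Implicit Defensive.

(* Two kinds of rounds alternate on the global circuit.  In a competition round
   every candidate tosses a fair coin and beeps on heads; a candidate with tails
   that hears a beep drops out.  So some candidate always survives, while two
   given candidates both survive m such rounds with probability at most 2^-m.  In
   a clock round every running amoebot beeps, and each running amoebot stops
   independently with probability 1 - rho^2; the first silent clock round ends
   the election.  The clock thus runs for the maximum of n independent geometric
   times, which is of order log n, and rho close to 1 makes it slow enough for the
   competition to be over before it stops. *)

Local Notation expR := sequences.expR.

(** * Expectations over independent biased coins *)

Section Coins.
Variables (R : realType) (V : finType) (w : V -> bool -> R).
Hypotheses (w_ge0 : forall v b, 0 <= w v b) (w_sum1 : forall v, w v true + w v false = 1).

Definition coin_expect (F : {ffun V -> bool} -> R) : R :=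
  \sum_(b : {ffun V -> bool}) (\prod_v w v (b v)) * F b.

Lemma coin_expect_prod (F : V -> bool -> R) :
  coin_expect (fun b => \prod_v F v (b v)) =
  \prod_v (w v true * F v true + w v false * F v false).
Proof.
rewrite /coin_expect; under [LHS]eq_bigr => b _ do rewrite -big_split /=.
rewrite -(bigA_distr_bigA (fun v b => w v b * F v b)).
by apply: eq_bigr => v _; rewrite big_bool.
Qed.

Lemma coin_expect_cst (a : R) : coin_expect (fun=> a) = a.
Proof.
rewrite /coin_expect -mulr_suml -[RHS]mul1r; congr (_ * _).
transitivity (coin_expect (fun b => \prod_(v : V) 1)).
  by apply: eq_bigr => b _; rewrite [X in _ = _ * X]big1 ?mulr1.
by rewrite (coin_expect_prod (fun _ _ => 1)) big1 // => v _; rewrite !mulr1.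
Qed.

Lemma coin_expect_le (F G : {ffun V -> bool} -> R) :
  (forall b, F b <= G b) -> coin_expect F <= coin_expect G.
Proof.
by move=> FG; apply: ler_sum => b _; rewrite ler_wpM2l // prodr_ge0.
Qed.

Lemma coin_expect_bound (F : {ffun V -> bool} -> R) (a : R) :
  (forall b, F b <= a) -> coin_expect F <= a.
Proof. by move=> Fa; rewrite -[leRHS]coin_expect_cst; apply: coin_expect_le. Qed.

Lemma coin_expectZ (a : R) F : coin_expect (fun b => a * F b) = a * coin_expect F.
Proof.
by rewrite /coin_expect big_distrr /=; apply: eq_bigr => b _; rewrite mulrCA.
Qed.

Lemma coin_expect_sum (I : finType) (F : I -> {ffun V -> bool} -> R) :
  coin_expect (fun b => \sum_i F i b) = \sum_i coin_expect (F i).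
Proof.
by rewrite /coin_expect exchange_big; apply: eq_bigr => b _; rewrite mulr_sumr.
Qed.

(** Independence: padding [F] and [G] with the constant 1 at all other coins gives a product over
    [V], and each padded factor has expectation 1. *)
Lemma coin_expect_pair (u v : V) (F G : bool -> R) : u != v ->
  coin_expect (fun b => F (b u) * G (b v)) =
  (w u true * F true + w u false * F false) *
  (w v true * G true + w v false * G false).
Proof.
move=> uv.
pose H x (c : bool) := if x == u then F c else if x == v then G c else 1.
have -> : coin_expect (fun b => F (b u) * G (b v)) =
          coin_expect (fun b => \prod_x H x (b x)).
  apply: eq_bigr => b _; congr (_ * _).
  rewrite (bigD1 u) //= (bigD1 v) 1?eq_sym //= big1 ?mulr1.
    by rewrite /H eqxx eq_sym (negbTE uv) eqxx.
  by move=> x /andP[/negbTE xu /negbTE xv]; rewrite /H xu xv.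
rewrite coin_expect_prod (bigD1 u) //= (bigD1 v) 1?eq_sym //= big1 ?mulr1.
  by rewrite /H eqxx eq_sym (negbTE uv) eqxx.
by move=> x /andP[/negbTE xu /negbTE xv]; rewrite /H xu xv !mulr1 w_sum1.
Qed.

Lemma coin_expect_single (u : V) (F : bool -> R) :
  coin_expect (fun b => F (b u)) = w u true * F true + w u false * F false.
Proof.
pose H x (c : bool) := if x == u then F c else 1.
have -> : coin_expect (fun b => F (b u)) =
          coin_expect (fun b => \prod_x H x (b x)).
  apply: eq_bigr => b _; congr (_ * _).
  rewrite (bigD1 u) //= big1 ?mulr1 /H ?eqxx //.
  by move=> x /negbTE ->.
rewrite coin_expect_prod (bigD1 u) //= big1 /H ?eqxx ?mulr1 //.
by move=> x /negbTE ->; rewrite !mulr1 w_sum1.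
Qed.

End Coins.

(** * The finite state machine of one amoebot *)

(** The phase names the kind of beep now on the circuit: [Some true] for competition, [Some false]
    for clock, [None] once the election has ended. The bits are candidacy, the coin shown in the
    competition, and whether the amoebot's own clock still runs. *)
Definition amem : finType := (option bool * (bool * bool * bool))%type.
Definition phase (m : amem) := m.1.
Definition cand (m : amem) := m.2.1.1.
Definition coin (m : amem) := m.2.1.2.
Definition alive (m : amem) := m.2.2.

Definition beeps (m : amem) : bool :=
  match phase m with
  | Some true => cand m && coin m
  | Some false => alive m
  | None => false
  end.

(** One random bit per round suffices: in the competition phase [b] decides whether the clock goes
    on, in the clock phase it is the coin for the next competition. *)
Definition step (m : amem) (heard b : bool) : amem :=
  match phase m with
  | Some true =>
      (Some false, (cand m && (coin m || ~~ heard), false, alive m && b))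
  | Some false =>
      if heard then (Some true, (cand m, b, alive m))
      else (None, (cand m, false, alive m))
  | None => m
  end.

(** * The Markov chain of the joint memories and its tail bounds *)

Section Chain.
Variables (R : realType) (rho : R).
Hypothesis rho01 : 0 < rho < 1.

(** A clock is tossed only every other round, so survival probability [rho ^+ 2] amounts to a factor
    [rho] per round. *)
Definition toss (m : amem) (b : bool) : R :=
  let p := if phase m == Some true then rho ^+ 2 else 2^-1 in
  if b then p else 1 - p.

Lemma toss_ge0 m b : 0 <= toss m b.
Proof.
have /andP[r0 r1] := rho01.
have [q0 q1] : 0 <= rho ^+ 2 /\ rho ^+ 2 <= 1.
  by rewrite exprn_ge0 ?exprn_ile1 // ltW.
by rewrite /toss; case: b; case: ifP => _; lra.
Qed.

Lemma toss_sum1 m : toss m true + toss m false = 1.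
Proof. by rewrite /toss addrC subrK. Qed.

Variable V : finType.
Notation state := {ffun V -> amem}.

Definition heard (s : state) : bool := [exists u, beeps (s u)].

Definition next_state (s : state) (b : {ffun V -> bool}) : state :=
  [ffun v => step (s v) (heard s) (b v)].

(** The transition operator of the chain: [iter t after F s] is the expectation of [F] after [t]
    rounds from [s]. *)
Definition after (F : state -> R) (s : state) : R :=
  coin_expect (fun v => toss (s v)) (fun b => F (next_state s b)).

Definition finished (s : state) : bool := [forall v, phase (s v) == None].

(** The invariant of the chain. The second clause guarantees a leader; the last two tie termination
    to the clocks: a competition phase follows a clock beep, the end follows silence. *)
Definition valid (s : state) : Prop :=
  [/\ exists p, forall v, phase (s v) = p,
      exists v, cand (s v),
      forall v, phase (s v) = Some true -> exists u, alive (s u) &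
      forall v, phase (s v) = None -> ~~ alive (s v)].

Lemma valid_next s b : valid s -> valid (next_state s b).
Proof.
case=> -[p hp] [v0 cv0] hT hN.
have hs v : s v = (p, (s v).2) by rewrite -(hp v); case: (s v).
split.
- exists (match p with Some true => Some false
    | Some false => if heard s then Some true else None | None => None end) => v.
  rewrite ffunE /step hp; case: (p) (hp v) => [[]|] // hpv; by case: (heard s).
- case: p hp {hs} => [[]|] hp.
  (* If a beep was heard, its sender stays a candidate; in silence nobody drops out. *)
  + case: (boolP (heard s)) => hh.
    * have /existsP[u] := hh; rewrite /beeps hp => /andP[cu ku].
      by exists u; rewrite ffunE /step hp /cand /= -/(cand _) cu ku.
    * exists v0; rewrite ffunE /step hp /cand /= -/(cand _) cv0 (negbTE hh).
      by rewrite orbT.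
  + by exists v0; rewrite ffunE /step hp; case: (heard s).
  + by exists v0; rewrite ffunE /step hp.
- move=> v; rewrite ffunE /step hp.
  case: p hp {hs} => [[]|] hp //; last by rewrite hp.
  case: (boolP (heard s)) => // /existsP[u]; rewrite /beeps hp => au _.
  exists u; rewrite ffunE /step hp.
  by case: (heard s).
- move=> v; rewrite ffunE /step hp.
  case: p hp {hs} => [[]|] hp //; last by move=> _; apply: hN; rewrite hp.
  case: (boolP (heard s)) => // /existsPn/(_ v); rewrite /beeps hp.
  by [].
Qed.

Lemma finished_next s b : finished s -> next_state s b = s.
Proof.
move=> /forallP fs; apply/ffunP => v; rewrite ffunE /step.
by rewrite (eqP (fs v)).
Qed.

Lemma cand_next s b v : cand (next_state s b v) -> cand (s v).
Proof.
rewrite ffunE /step; case: (phase (s v)) => [[]|] //; last by case: (heard s).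
by case/andP.
Qed.

Lemma after_le (F G : state -> R) s : valid s ->
  (forall s', valid s' -> F s' <= G s') -> after F s <= after G s.
Proof.
move=> Is FG; apply: coin_expect_le => [v b|b]; first exact: toss_ge0.
by apply: FG; apply: valid_next.
Qed.

Lemma after_bound (F : state -> R) (a : R) s :
  (forall b, F (next_state s b) <= a) -> after F s <= a.
Proof.
apply: coin_expect_bound => [v b|v]; [exact: toss_ge0 | exact: toss_sum1].
Qed.

(** The potential method behind the next tail bounds: a dominating function that contracts in
    expectation passes its geometric decay on to [F]. *)
Lemma iter_after_decay (F H : state -> R) (a : R) t s :
  0 <= a ->
  (forall s, valid s -> F s <= H s) ->
  (forall s, valid s -> after H s <= a * H s) ->
  valid s -> iter t after F s <= a ^+ t * H s.
Proof.
move=> a0 FH HH; elim: t s => [|t IH] s Is; first by rewrite mul1r FH.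
rewrite iterS; apply: le_trans (after_le Is IH) _.
rewrite /after coin_expectZ exprSr -mulrA ler_wpM2l ?exprn_ge0 //.
exact: HH.
Qed.

(** Termination requires every clock to have stopped, and the clocks are independent. Every round is
    charged a full clock toss, hence the exponent [2 * t], although only every other round makes
    one. *)
Lemma finished_bound t s : valid s ->
  iter t after (fun s => (finished s)%:R) s <=
  \prod_v (if alive (s v) then 1 - rho ^+ (2 * t) else 1).
Proof.
have /andP[r0 r1] := rho01.
have rt (i : nat) : 0 <= rho ^+ i <= 1 by rewrite exprn_ge0 ?exprn_ile1 ?ltW.
elim: t s => [|t IH] s Is.
  rewrite /=; case: (boolP (finished s)) => [/forallP fs|_]; last first.
    by apply: prodr_ge0 => v _; case: ifP; rewrite ?subrr.
  rewrite big1 // => v _; case: Is => _ _ _ /(_ v (eqP (fs v))).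
  by move/negbTE ->.
rewrite iterS; apply: le_trans (after_le Is IH) _.
pose d i m : R := if alive m then 1 - rho ^+ (2 * i) else 1.
rewrite /after.
have -> : coin_expect (fun v => toss (s v)) (fun b =>
    \prod_v (if alive (next_state s b v) then 1 - rho ^+ (2 * t) else 1)) =
  coin_expect (fun v => toss (s v)) (fun b =>
    \prod_v d t (step (s v) (heard s) (b v))).
  by apply: eq_bigr => b _; congr (_ * _); apply: eq_bigr => v _; rewrite ffunE.
rewrite (coin_expect_prod _ (fun v c => d t (step (s v) (heard s) c))).
apply: ler_prod => v _; apply/andP; split.
  by rewrite addr_ge0 // mulr_ge0 ?toss_ge0 // /d; case: ifP => // _;
     have := rt (2 * t)%N; lra.
rewrite /toss /d /step.
have := rt (2 * t)%N; rewrite mulnS exprD.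
have := rt 2%N; move: (rho ^+ 2) (rho ^+ (2 * t)) => q x.
case: (s v) => [[[]|] [[ca co] []]]; rewrite /phase /alive /cand /coin /=;
  case: (heard s) => /=; nra.
Qed.

(** Up to one round of delay, an unfinished election needs a running clock, and the expected number
    of running clocks decays. *)
Lemma unfinished_bound t s : valid s -> (forall v, phase (s v) = Some true) ->
  iter t.+1 after (fun s => (~~ finished s)%:R) s <= #|V|%:R * rho ^+ t.
Proof.
have /andP[r0 r1] := rho01; have ri : 0 < rho^-1 by rewrite invr_gt0.
have rI : 1 <= rho^-1 by rewrite invf_ge1 // ltW.
(* The weight [rho^-1] spreads the loss [rho ^+ 2] of a competition step over two rounds: both kinds
   of round now lose a factor [rho]. *)
pose h m : R := (alive m)%:R *
  match phase m with Some true => 1 | Some false => rho^-1 | None => 0 end.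
have h0 m : 0 <= h m.
  by rewrite /h mulr_ge0 //; case: (phase m) => [[]|] //; apply: ltW.
(* The last round is split off: in a clock phase with all clocks stopped the potential is already 0,
   but the silence is noticed only one round later. *)
move=> Is sC; rewrite iterSr mulrC.
apply: (@le_trans _ _ (rho ^+ t * \sum_v h (s v))); last first.
  rewrite ler_wpM2l ?exprn_ge0 //; first exact: ltW.
  rewrite -sum1_card natr_sum ler_sum // => v _.
  by rewrite /h sC mulr1; case: (alive _).
apply: (@iter_after_decay _ (fun s => \sum_v h (s v))) => // [|{Is sC}s Is|{Is sC}s Is].
- exact: ltW.
- apply: after_bound => b; case: (Is) => -[p hp] [v0 _] hT hN.
  have H1 u : h (s u) <= \sum_v h (s v).
    by rewrite (bigD1 u) //= lerDl sumr_ge0.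
  case: (boolP (finished _)) => nf /=; first exact: sumr_ge0.
  case: p hp => [[]|] hp.
  + have [u au] := hT v0 (hp v0); apply: le_trans (H1 u).
    by rewrite /h au hp mulr1.
  + case: (boolP (heard s)) => hh.
      have /existsP[u] := hh; rewrite /beeps hp => au; apply: le_trans (H1 u).
      by rewrite /h au hp mul1r.
    case/negP: nf; apply/forallP => v; rewrite ffunE /step hp (negbTE hh).
    by [].
  + case/negP: nf; apply/forallP => v; rewrite ffunE /step hp.
    by rewrite hp.
- rewrite mulr_sumr /after.
  have -> : coin_expect (fun v => toss (s v)) (fun b => \sum_v h (next_state s b v)) =
    \sum_v coin_expect (fun v => toss (s v)) (fun b => h (step (s v) (heard s) (b v))).
    rewrite -coin_expect_sum; apply: eq_bigr => b _; congr (_ * _).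
    by apply: eq_bigr => v _; rewrite ffunE.
  apply: ler_sum => v _.
  rewrite (coin_expect_single _ v (fun c => h (step (s v) (heard s) c))); last first.
    by move=> x; apply: toss_sum1.
  have rr : rho * rho^-1 = 1 by rewrite divff // gt_eqF.
  have rr2 : rho ^+ 2 * rho^-1 = rho by rewrite expr2 -mulrA rr mulr1.
  rewrite /toss /h /step.
  case: (s v) => [[[]|] [[ca co] []]]; rewrite /phase /alive /cand /coin /=;
  case: (heard s) => /=; rewrite ?mul1r ?mul0r ?mulr0 ?mulr1 ?rr ?rr2; lra.
Qed.

(** Two rivals survive a competition only with equal coins. The event asks for an unfinished
    election because candidates no longer drop out after the end. *)
Lemma rivals_bound t s (u v : V) : u != v -> valid s ->
  iter t.+1 after
    (fun s => [&& ~~ finished s, cand (s u) & cand (s v)]%:R) s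
  <= 4 / 3 * (3 / 4) ^+ t.
Proof.
(* The last round is split off again: unequal coins make the potential 0 one round before a rival
   drops out. *)
move=> uv Is; rewrite iterSr.
(* Coins agree with probability 1/2 once in two rounds, and 1/2 <= (3/4)^2, so 3/4 is a valid rate
   per round. The scaling by 4/3 below lifts the clock-phase weight 3/4 to 1. *)
pose h (s : state) : R :=
  match phase (s u) with
  | Some true => [&& cand (s u), cand (s v) & coin (s u) == coin (s v)]%:R
  | Some false => 3 / 4 * (cand (s u) && cand (s v))%:R
  | None => 0
  end.
have hle s' : h s' <= 1.
  by rewrite /h; case: (phase _) => [[]|] //; [case: (_ && _) => /=|case: (_ && _) => /=; lra].
have h0 s' : 0 <= h s'.
  by rewrite /h; case: (phase _) => [[]|] //; case: (_ && _) => /=; lra.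
apply: (@le_trans _ _ ((3 / 4) ^+ t * (4 / 3 * h s))); last first.
  have p0 : 0 <= (3 / 4 : R) ^+ t by apply: exprn_ge0; lra.
  by rewrite mulrCA mulrA ler_piMr // mulr_ge0 //; lra.
(* Of two candidates with different coins the one with tails drops out. *)
have drop (s' : state) b : phase (s' u) = Some true -> phase (s' v) = Some true ->
    cand (next_state s' b u) && cand (next_state s' b v) -> h s' = 1.
  move=> pu pv; rewrite !ffunE /step pu pv /cand /= -!/(cand _).
  move=> /andP[/andP[cu ku] /andP[cv kv]]; rewrite /h pu cu cv /=.
  have hu : coin (s' u) -> heard s'.
    by move=> k1; apply/existsP; exists u; rewrite /beeps pu cu.
  have hv : coin (s' v) -> heard s'.
    by move=> k1; apply/existsP; exists v; rewrite /beeps pv cv.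
  case: (coin (s' u)) (coin (s' v)) ku kv hu hv => [] [] //=.
    by move=> _ /negP hh /(_ isT).
  by move=> /negP hh _ _ /(_ isT).
apply: (@iter_after_decay _ (fun s => 4 / 3 * h s)) => // [|{}s {}Is|{}s {}Is]; first lra.
  case: (Is) => -[p hp] _ _ _.
  apply: after_bound => b.
  case: (boolP (finished _)) => /= nf; first by have := h0 s; lra.
  case: (boolP (_ && _)) => cc; last by have := h0 s; rewrite /=; lra.
  case: p hp => [[]|] hp.
  - by rewrite (drop s b) ?hp //=; lra.
  - have /andP[/cand_next cu /cand_next cv] := cc.
    by rewrite /h hp cu cv /=; lra.
  - by case/negP: nf; apply/forallP => x; rewrite ffunE /step hp hp.
rewrite {1}/after coin_expectZ mulrCA ler_wpM2l //; first lra.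
rewrite -/(after h s).
case: (Is) => -[p hp] _ _ _.
case: p hp => [[]|] hp.
- apply: after_bound => b.
  have pn : phase (next_state s b u) = Some false by rewrite ffunE /step hp.
  rewrite {1}/h pn.
  case: (boolP (cand (next_state s b u) && _)) => cc; last by have := h0 s; rewrite /=; lra.
  by rewrite (drop s b) ?hp //=; lra.
- case: (boolP (heard s)) => hh; last first.
    apply: after_bound => b; rewrite {1}/h ffunE /step hp (negbTE hh) /phase /=.
    by have := h0 s; lra.
  rewrite {2}/h hp.
  (* The index [k] is the common value of the two fresh coins. *)
  have hb b : h (next_state s b) = \sum_(k : bool) (cand (s u) && cand (s v))%:R *
      ((b u == k)%:R * (b v == k)%:R).
    rewrite /h !ffunE /step !hp hh /phase /cand /coin /= big_bool /=.
    by case: (_.1.1); case: (_.1.1); case: (b u); case: (b v); rewrite /=; lra.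
  have -> : after h s = coin_expect (fun x => toss (s x)) (fun b =>
      \sum_(k : bool) (cand (s u) && cand (s v))%:R *
        ((b u == k)%:R * (b v == k)%:R)).
    by apply: eq_bigr => b _; rewrite hb.
  rewrite coin_expect_sum big_bool /= !coin_expectZ.
  rewrite (coin_expect_pair _ (fun c => (c == true)%:R) (fun c => (c == true)%:R)) //;
    last by move=> x; apply: toss_sum1.
  rewrite (coin_expect_pair _ (fun c => (c == false)%:R) (fun c => (c == false)%:R)) //;
    last by move=> x; apply: toss_sum1.
  rewrite /toss !hp /=; case: (_ && _) => /=; lra.
- by apply: after_bound => b; rewrite /h ffunE /step !hp; lra.
Qed.

End Chain.

(** * Expectations along paths of a Markov kernel *)

Lemma sum_tuple_cons (R : nmodType) (T : finType) N (F : N.+1.-tuple T -> R) :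
  \sum_w F w = \sum_x \sum_(w : N.-tuple T) F [tuple of x :: w].
Proof.
rewrite pair_big /=.
rewrite (reindex (fun p : T * N.-tuple T => [tuple of p.1 :: p.2])) //=.
exists (fun w => (thead w, [tuple of behead w])) => [[x w]|w] _ /=.
  by congr pair; apply: val_inj.
by rewrite -tuple_eta.
Qed.

(** The steps after time [t] sum out to 1 because the rows of [K] do; the first [t] steps unfold
    into iterates of the transition operator. *)
Lemma sum_paths (R : realType) (T : finType) (K : T -> T -> R)
    (f : T -> R) (d x : T) N t :
  (forall x, \sum_y K x y = 1) -> (t <= N)%N ->
  \sum_(w : N.-tuple T)
     (\prod_(i < N) K (nth d (x :: w) i) (nth d (x :: w) i.+1)) * f (nth d (x :: w) t) =
  iter t (fun F x => \sum_y K x y * F y) f x.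
Proof.
move=> K1; elim: N f x t => [|N IH] f x t tN.
  move: tN; rewrite leqn0 => /eqP -> /=; rewrite (big_pred1 [tuple]).
    by rewrite big_ord0 mul1r.
  by move=> w; rewrite [w]tuple0 /= eq_refl.
have E y (w : N.-tuple T) :
    \prod_(i < N.+1) K (nth d (x :: [tuple of y :: w]) i)
                       (nth d (x :: [tuple of y :: w]) i.+1) =
    K x y * \prod_(i < N) K (nth d (y :: w) i) (nth d (y :: w) i.+1).
  by rewrite big_ord_recl.
rewrite sum_tuple_cons; case: t tN => [|t] tN.
  rewrite /= -[RHS]mul1r -{2}(K1 x) mulr_suml; apply: eq_bigr => y _.
  under eq_bigr do rewrite E.
  rewrite -mulr_suml -mulr_sumr; congr (_ * _); rewrite -[RHS]mulr1; congr (_ * _).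
  by apply: etrans (IH (fun=> 1) y 0%N isT); apply: eq_bigr => w _; rewrite mulr1.
rewrite iterS; apply: eq_bigr => y _; rewrite -IH // mulr_sumr.
by apply: eq_bigr => w _; rewrite E mulrA.
Qed.

(** * Connectivity of the global circuit *)

Lemma nbrK (v : node) (d : 'I_6) : exists d', nbr (nbr v d) d' = v.
Proof.
suff [d' dd'] : exists d', offset d + offset d' = 0.
  by exists d'; rewrite /nbr -addrA dd' addr0.
(* Directions three apart in the cyclic order are opposite. *)
exists (inZp (d + 3)); apply/eqP.
by case: d => [] [|[|[|[|[|[|]]]]]].
Qed.

Section GlobalCircuit.
Variables (k : nat) (S : {fset node}) (lab : labelling S).
Variables (R : realType) (A : protocol R k).
Hypothesis S_connected : connected_structure S.
Variable g : {ffun S -> outcome (memory A) k}.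

Definition pin_at (v : S) (p : all_pins k S) : Prop :=
  exists d j, val p = edge_pin (val v) d j.

Lemma pin_at_exists (v : S) d (j : 'I_k) :
  exists p : all_pins k S, val p = edge_pin (val v) d j.
Proof.
have h : edge_pin (val v) d j \in all_pins k S.
  by apply/imfsetP; exists (v, (d, j)).
by exists [` h].
Qed.

Lemma edge_pin_label (v : S) d (j : 'I_k) :
  exists l, pin_of lab v l = edge_pin (val v) d j.
Proof. by exists ((lab v)^-1%g d, j); rewrite /pin_of /= permKV. Qed.

(** [part_of] counts only pins on edges to occupied nodes. The first step of a path to a second
    amoebot supplies such an edge. *)
Lemma has_neighbour (v : S) : (1 < #|` S|)%N -> exists d, nbr (val v) d \in S.
Proof.
move=> n1; have [u uv] : exists u : S, u != v.
  apply/existsP; apply: contraLR n1; rewrite negb_exists => /forallP h.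
  rewrite -leqNgt cardfE; apply: (@leq_trans #|[set v]|); last by rewrite cards1.
  by apply: subset_leq_card; apply/subsetP => x _; have := h x; rewrite inE negbK.
have /connectP[[|x s] /=] := S_connected.2 v u.
  by move=> _ uE; rewrite uE eqxx in uv.
case/andP => /existsP[d /eqP dx] _ _; exists d; rewrite dx.
exact: valP.
Qed.

Section AllJoined.
Hypothesis joined : forall v, (g v).2.1 = setT.

Lemma wired_at v p q : pin_at v p -> pin_at v q -> wired lab g p q.
Proof.
move=> [d [j pE]] [d' [j' qE]].
have [l lE] := edge_pin_label v d j; have [l' lE'] := edge_pin_label v d' j'.
apply/existsP; exists v; apply/existsP; exists (l, l').
by rewrite joined inE /= lE lE' pE qE !eqxx.
Qed.

(** Induction along a path of amoebots: a pin on the bond between consecutive ones belongs to both,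
    so it links their wires. *)
Lemma connect_pins u v p q :
  pin_at u p -> pin_at v q -> connect (wired lab g) p q.
Proof.
move=> pu qv; have /connectP[s] := S_connected.2 u v.
elim: s u p pu => [|x s IH] u p pu /=.
  by move=> _ vu; apply/connect1/(wired_at (v := u)) => //; rewrite -vu.
move=> /andP[/existsP[d /eqP dx] xs] vE.
have [d0 [j _]] := pu.
have [r rE] := pin_at_exists u d j.
have ru : pin_at u r by exists d, j.
have rx : pin_at x r.
  have [d' d'E] := nbrK (val u) d; rewrite dx in d'E.
  exists d', j; rewrite rE /edge_pin; congr (_, _).
  by rewrite dx d'E fsetUC.
apply: connect_trans (IH x r rx xs vE).
exact/connect1/(wired_at pu ru).
Qed.

End AllJoined.

(** The global circuit acts as a single shared bit. The alternative without beeps covers the initial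
    configuration, where nothing is wired yet. *)
Lemma received_neq0 (v : S) : (0 < k)%N -> (1 < #|` S|)%N ->
  (forall u, (g u).2.2 = set0 \/ (g u).2.2 = setT) ->
  (forall u, (g u).2.1 = setT) \/ (forall u, (g u).2.2 = set0) ->
  (received lab g v != set0) = [exists u, (g u).2.2 != set0].
Proof.
move=> k0 n1 h01 hw; apply/idP/idP.
  case/set0Pn => l; rewrite inE => /existsP[p /and3P[_ _ /existsP[u]]].
  case/andP => _ /existsP[x /andP[xu _]]; apply/existsP; exists u.
  by apply/set0Pn; exists x.
case/existsP => u gu; case: hw => [hw|/(_ u) h0]; last by rewrite h0 eqxx in gu.
have {}gu : (g u).2.2 = setT by case: (h01 u) => // e; rewrite e eqxx in gu.
pose j0 : 'I_k := Ordinal k0.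
have [p pE] := pin_at_exists v ord0 j0.
have pv : pin_at v p by exists ord0, j0.
have part x : part_of x (circuit lab g p).
  have [d dS] := has_neighbour x n1.
  apply/existsP; exists d; apply/existsP; exists j0; rewrite dS /=.
  have [q qE] := pin_at_exists x d j0.
  apply/existsP; exists q; rewrite qE eqxx andbT inE.
  by apply: (connect_pins hw pv (v := x)); exists d, j0.
have [l lE] := edge_pin_label v ord0 j0.
apply/set0Pn; exists l; rewrite inE; apply/existsP; exists p.
rewrite pE lE eqxx part /=; apply/existsP; exists u; rewrite /beeps_on part /=.
have [q qE] := pin_at_exists u ord0 j0.
have [m mE] := edge_pin_label u ord0 j0.
apply/existsP; exists m; rewrite gu inE /=.
apply/existsP; exists q; rewrite qE mE eqxx andbT inE.
by apply: (connect_pins hw pv (v := u)); exists ord0, j0.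
Qed.

End GlobalCircuit.

(** * The protocol and its executions *)

Section LeaderProtocol.
Variables (R : realType) (k : nat) (rho : R).
Hypothesis rho01 : 0 < rho < 1.

Definition act (m : amem) : outcome amem k :=
  (m, (setT, if beeps m then setT else set0)).

(** The image of [toss] under [step]; as a sum over [b], it adds up both tosses when they lead to
    the same outcome. *)
Definition act_law (m : amem) (B : {set lpin k}) (x : outcome amem k) : R :=
  \sum_(b : bool) toss rho m b * (x == act (step m (B != set0) b))%:R.

Lemma act_law_ge0 m B x : 0 <= act_law m B x.
Proof. by apply: sumr_ge0 => b _; rewrite mulr_ge0 // toss_ge0. Qed.

Lemma act_law_sum1 m B : \sum_x act_law m B x = 1.
Proof.
rewrite exchange_big /= -[RHS](toss_sum1 rho m) big_bool.
have single (c : R) (a : outcome amem k) : \sum_x c * (x == a)%:R = c.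
  rewrite (bigD1 a) //= eqxx mulr1 big1 ?addr0 // => x /negbTE ->.
  by rewrite mulr0.
by congr (_ + _); apply: single.
Qed.

Lemma act_law_gt0 m B x :
  0 < act_law m B x -> exists b, x = act (step m (B != set0) b).
Proof.
move=> h; have [b /eqP] : exists b, x == act (step m (B != set0) b).
  apply/existsP; apply: contraLR h; rewrite negb_exists => /forallP h.
  by rewrite /act_law big1 ?ltxx // => b _; rewrite (negbTE (h b)) mulr0.
by exists b.
Qed.

Definition role_of (m : amem) : role :=
  if phase m is None then (if cand m then Leader else NonLeader) else Undecided.

(** The coin shows tails, in accordance with the silent initial configuration; the first competition
    eliminates nobody. *)
Definition start : amem := (Some true, (true, false, true)).

Definition leader_protocol : protocol R k :=
  Protocol start
    (fun m B => FDist (act_law_ge0 m B) (act_law_sum1 m B)) role_of.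

Lemma leader_protocol_global : global_circuit_only leader_protocol.
Proof.
move=> q B x /act_law_gt0[b ->] p p' /=.
by apply: connect1; rewrite inE.
Qed.

Lemma leader_protocol_irrevocable : irrevocable leader_protocol.
Proof.
move=> q B x /act_law_gt0[b ->] /=.
by case: q => [[p|] c] // undecided; case: (undecided erefl).
Qed.

Variables (S : {fset node}) (lab : labelling S).
Hypotheses (S_connected : connected_structure S) (S_gt1 : (1 < #|` S|)%N)
  (k_gt0 : (0 < k)%N).

Notation config := {ffun S -> outcome (memory leader_protocol) k}.
Notation state := {ffun S -> amem}.

Definition mem_of (g : config) : state := [ffun v => (g v).1].
Definition embed (s : state) : config := [ffun v => act (s v)].

(** The unwired initial configuration is not an [embed]; this condition includes it and still lets
    the memories determine the law of the next round. *)
Definition consistent (g : config) : Prop :=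
  (forall v, (g v).2.2 = if beeps (g v).1 then setT else set0) /\
  ((forall v, (g v).2.1 = setT) \/ (forall v, (g v).2.2 = set0)).

Lemma mem_of_embed s : mem_of (embed s) = s.
Proof. by apply/ffunP => v; rewrite !ffunE. Qed.

Lemma embed_consistent s : consistent (embed s).
Proof. by split=> [v|]; [|left=> v]; rewrite ffunE. Qed.

Lemma init_consistent : consistent (init_config leader_protocol S).
Proof. by split=> [v|]; [|right=> v]; rewrite ffunE. Qed.

Lemma lpins_neq0 : (setT : {set lpin k}) != set0.
Proof. by apply/set0Pn; exists (ord0, Ordinal k_gt0). Qed.

Lemma received_heard g v : consistent g ->
  (received lab g v != set0) = heard (mem_of g).
Proof.
move=> [gb gw]; rewrite (received_neq0 lab S_connected) //.
  apply: eq_existsb => u; rewrite gb ffunE; case: (beeps _); last by rewrite eqxx.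
  exact: lpins_neq0.
by move=> u; rewrite gb; case: (beeps _); [right|left].
Qed.

(** Expanding the product over amoebots of sums over their coins gives a sum over coin vectors, that
    is, one step of the chain on memories. *)
Lemma round_probE g g' : consistent g ->
  round_prob lab g g' =
  coin_expect (fun v => toss rho (mem_of g v))
    (fun b => (g' == embed (next_state (mem_of g) b))%:R).
Proof.
move=> cg; rewrite /round_prob /= /act_law.
under eq_bigr do rewrite received_heard //.
rewrite bigA_distr_bigA; apply: eq_bigr => b _; rewrite big_split /=.
congr (_ * _); first by apply: eq_bigr => v _; rewrite ffunE.
case: eqP => [->|/eqP ne].
  by rewrite big1 // => v _; rewrite !ffunE eqxx.
have /existsP[v nv] : [exists v, g' v != embed (next_state (mem_of g) b) v].
  apply: contraNT ne => /existsPn h; apply/eqP/ffunP => v.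
  by have := h v; rewrite negbK => /eqP.
by rewrite (bigD1 v) //=; move: nv; rewrite !ffunE => /negbTE ->; rewrite mul0r.
Qed.

Lemma round_prob_expect g (F : config -> R) : consistent g ->
  \sum_g' round_prob lab g g' * F g' =
  coin_expect (fun v => toss rho (mem_of g v))
    (fun b => F (embed (next_state (mem_of g) b))).
Proof.
move=> cg; under eq_bigr do rewrite round_probE // /coin_expect mulr_suml.
rewrite exchange_big; apply: eq_bigr => b _ /=.
under eq_bigr do rewrite -mulrA.
rewrite -mulr_sumr; congr (_ * _).
rewrite (bigD1 (embed (next_state (mem_of g) b))) //= eqxx mul1r big1 ?addr0 // => h.
by move/negbTE ->; rewrite mul0r.
Qed.

Lemma round_prob_support g g' : consistent g -> round_prob lab g g' != 0 ->
  exists b, g' = embed (next_state (mem_of g) b).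
Proof.
move=> cg h; have [b /eqP] : exists b, g' == embed (next_state (mem_of g) b).
  apply/existsP; apply: contraNT h => /existsPn h.
  rewrite round_probE // /coin_expect big1 // => b _.
  by rewrite (negbTE (h b)) mulr0.
by exists b.
Qed.

Lemma round_prob_ge0 g g' : 0 <= round_prob (A := leader_protocol) lab g g'.
Proof. by apply: prodr_ge0 => v _; apply: pmf_ge0. Qed.

Lemma round_prob_sum1 g : \sum_g' round_prob (A := leader_protocol) lab g g' = 1.
Proof.
rewrite /round_prob -(bigA_distr_bigA (fun v x =>
  trans (g v).1 (received lab g v) x)).
by rewrite big1 // => v _; apply: pmf_sum1.
Qed.

Definition start_state : state := [ffun=> start].

Lemma start_valid : valid start_state.
Proof.
have /fset0Pn[v vS] := S_connected.1; pose v0 : S := [` vS].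
split=> [|| x _ | x]; rewrite ?ffunE //.
- by exists (Some true) => x; rewrite ffunE.
- by exists v0; rewrite ffunE.
- by exists v0; rewrite ffunE.
Qed.

(** Carries the tail bounds of the chain over to executions: every successor of a consistent
    configuration is an [embed], hence consistent again. *)
Lemma run_expect N (F : state -> R) t : (t <= N)%N ->
  \sum_(w : N.-tuple config) run_prob lab w * F (mem_of (config_at w t)) =
  iter t (after rho (V := S)) F start_state.
Proof.
move=> tN; rewrite /run_prob /config_at.
rewrite (@sum_paths R config (round_prob lab) (F \o mem_of)) //; last first.
  exact: round_prob_sum1.
have -> : start_state = mem_of (init_config leader_protocol S).
  by apply/ffunP => v; rewrite !ffunE.
elim: t {tN} (init_config _ _) init_consistent => [|t IH] g cg //.
rewrite !iterS round_prob_expect //; apply: eq_bigr => b _.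
by rewrite IH ?mem_of_embed //; apply: embed_consistent.
Qed.

Lemma run_prob_ge0 N (w : N.-tuple config) : 0 <= run_prob lab w.
Proof. by apply: prodr_ge0 => i _; apply: round_prob_ge0. Qed.

Lemma run_sum1 N : \sum_(w : N.-tuple config) run_prob lab w = 1.
Proof.
apply: etrans (run_expect (fun=> 1) (leq0n N)); by apply: eq_bigr => w _; rewrite mulr1.
Qed.

Lemma run_round N (w : N.-tuple config) t : run_prob lab w != 0 -> (t < N)%N ->
  consistent (config_at w t) ->
  exists b, config_at w t.+1 = embed (next_state (mem_of (config_at w t)) b).
Proof.
move=> w0 tN cg; apply: round_prob_support => //.
by apply: contraNneq w0 => h; rewrite /run_prob (bigD1 (Ordinal tN)) //= h mul0r.
Qed.

Lemma run_support N (w : N.-tuple config) t : run_prob lab w != 0 -> (t <= N)%N ->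
  consistent (config_at w t) /\ valid (mem_of (config_at w t)).
Proof.
move=> w0; elim: t => [|t IH] tN.
  split; first exact: init_consistent.
  suff -> : mem_of (config_at w 0) = start_state by apply: start_valid.
  by apply/ffunP => v; rewrite !ffunE.
have [cg ig] := IH (ltnW tN).
have [b ->] := run_round w0 tN cg.
split; first exact: embed_consistent.
by rewrite mem_of_embed; apply: valid_next.
Qed.

Lemma run_step N (w : N.-tuple config) t : run_prob lab w != 0 -> (t < N)%N ->
  exists b, mem_of (config_at w t.+1) = next_state (mem_of (config_at w t)) b.
Proof.
move=> w0 tN; have [cg _] := run_support w0 (ltnW tN).
have [b ->] := run_round w0 tN cg.
by exists b; rewrite mem_of_embed.
Qed.

Lemma run_cand N (w : N.-tuple config) s t v : run_prob lab w != 0 ->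
  (s <= t <= N)%N ->
  cand (mem_of (config_at w t) v) -> cand (mem_of (config_at w s) v).
Proof.
move=> w0 /andP[]; elim: t => [|t IH]; first by rewrite leqn0 => /eqP ->.
rewrite leq_eqVlt => /orP[/eqP -> //|st] tN.
by have [b ->] := run_step w0 tN; move/cand_next; apply: IH => //; apply: ltnW.
Qed.

Lemma run_finished N (w : N.-tuple config) s t : run_prob lab w != 0 ->
  (s <= t <= N)%N ->
  finished (mem_of (config_at w s)) -> finished (mem_of (config_at w t)).
Proof.
move=> w0 /andP[]; elim: t => [|t IH]; first by rewrite leqn0 => /eqP ->.
rewrite leq_eqVlt => /orP[/eqP -> //|st] tN fs.
by have [b ->] := run_step w0 tN; rewrite finished_next; apply: IH => //; apply: ltnW.
Qed.

Lemma terminatedE (g : config) : terminated g = finished (mem_of g).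
Proof.
apply: eq_forallb => v; rewrite ffunE /= /role_of.
by case: (phase _) => //=; case: (cand _).
Qed.

(** Candidates only drop out and never all of them, so uniqueness at [t0] leaves exactly one leader
    at the first finished time, which lies between [t0] and [t1]. *)
Lemma elects_within_run N (w : N.-tuple config) (lo hi : R) t0 t1 :
  run_prob lab w != 0 -> lo <= t0%:R -> t1%:R <= hi -> (t1 <= N)%N ->
  ~~ finished (mem_of (config_at w t0)) -> finished (mem_of (config_at w t1)) ->
  (forall u v, u != v ->
    ~~ (cand (mem_of (config_at w t0) u) && cand (mem_of (config_at w t0) v))) ->
  (t0 <= N)%N ->
  elects_within lo hi w.
Proof.
move=> w0 lo0 hi1 t1N nf0 f1 uniq0 t0N.
have ex : exists t, finished (mem_of (config_at w t)) by exists t1.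
case: (ex_minnP ex) => t ft tmin.
have tt1 : (t <= t1)%N by apply: tmin.
have tN : (t <= N)%N := leq_trans tt1 t1N.
have t0t : (t0 < t)%N.
  rewrite ltnNge; apply: contraNN nf0 => tt0.
  by apply: run_finished ft => //; rewrite tt0.
apply/existsP; exists (Ordinal (tN : t < N.+1)%N) => /=.
apply/and3P; split.
- apply/andP; split.
    by apply: le_trans lo0 _; rewrite ler_nat ltnW.
  by apply: le_trans hi1; rewrite ler_nat.
- rewrite /leader_elected terminatedE ft /=.
  have [_ [_ [v cv] _ _]] := run_support w0 tN.
  apply/cards1P; exists v; apply/setP => u; rewrite !inE.
  have /forallP/(_ u) := ft; rewrite ffunE => /eqP pu.
  have -> : is_leader (role_of (config_at w t u).1) =
            cand (mem_of (config_at w t) u).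
    by rewrite /role_of ffunE pu; case: (cand _).
  have c0 x : cand (mem_of (config_at w t) x) -> cand (mem_of (config_at w t0) x).
    by apply: run_cand => //; rewrite ltnW.
  apply/idP/eqP => [cu|-> //]; apply/eqP; apply: contraT => /uniq0.
  by rewrite !c0.
- apply/forallP => s; apply/implyP => st; rewrite terminatedE.
  by apply: contraL st => /tmin; rewrite -leqNgt.
Qed.

End LeaderProtocol.

(* If [y = eta * ln n] is tiny, use [1 - expR (- y) <= y]; otherwise use
   [1 - expR (- y) <= expR (- expR (- y))]. The first case is what makes the
   bound hold even for small [n]. *)
Lemma all_stopped_bound (R : realType) (M : R) : 0 < M ->
  exists2 eta : R, 0 < eta & forall n : nat, (0 < n)%N ->
    (1 - expR (- (eta * ln n%:R))) ^+ n <= expR (- (M * ln n%:R)).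
Proof.
(* [K'] makes [expR ((K' - 1) * y)] at least [K] once [y >= expR (- K)]. The factor 2 in [K] is
   spent on [expR (x / 2) >= x / 2] with [x = ln n]. *)
move=> M0; pose K := 2 * M; pose K' := 1 + K * expR K.
have K0 : 0 < K by rewrite /K; lra.
have K'0 : 0 < K' by have := mulr_gt0 K0 (expR_gt0 K); rewrite /K'; lra.
have claim y : 0 <= y -> 1 - expR (- y) <= expR (- (K * expR (- (K' * y)))).
  move=> y0; case: (leP y (expR (- K))) => yK.
    have h1 := expR_ge1Dx (- y).
    have h2 : expR (- K) <= expR (- (K * expR (- (K' * y)))).
      rewrite ler_expR lerN2 -[leRHS]mulr1 ler_wpM2l ?(ltW K0) //.
      by rewrite expR_le1 oppr_le0 mulr_ge0 // ltW.
    by apply: le_trans h2; lra.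
  apply: (@le_trans _ _ (expR (- expR (- y)))); first exact: expR_ge1Dx.
  rewrite ler_expR lerN2.
  have -> : expR (- y) = expR (K * expR K * y) * expR (- (K' * y)).
    by rewrite -expRD; congr expR; rewrite /K'; ring.
  rewrite ler_wpM2r ?(ltW (expR_gt0 _)) //.
  have h : K <= K * expR K * y.
    rewrite -mulrA -[leLHS]mulr1 ler_wpM2l ?(ltW K0) //.
    by rewrite -(expRxMexpNx_1 K) ler_wpM2l ?(ltW (expR_gt0 _)) // ltW.
  by have := expR_ge1Dx (K * expR K * y); lra.
exists (2 * K')^-1 => [|n n0]; first by rewrite invr_gt0; lra.
have x0 : 0 <= ln n%:R :> R by rewrite ln_ge0 // ler1n.
have nE : n%:R = expR (ln n%:R) :> R by rewrite lnK // posrE ltr0n.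
move: (ln n%:R) x0 nE => x x0 nE.
have y0 : 0 <= (2 * K')^-1 * x by rewrite mulr_ge0 // invr_ge0; lra.
have /(lerXn2r n) h := claim _ y0.
apply: le_trans (h _ _) _; rewrite ?nnegrE ?expR_ge0 //.
  by rewrite subr_ge0 expR_le1 oppr_le0.
rewrite -expRM_natl ler_expR.
have -> : K' * ((2 * K')^-1 * x) = x / 2 by field; lra.
have -> : n%:R * - (K * expR (- (x / 2))) = - (K * expR (x / 2)).
  rewrite nE mulrN mulrCA -expRD; congr (- (K * expR _)); lra.
rewrite lerN2 -[K]/(2 * M) -mulrA mulrCA ler_wpM2l ?(ltW M0) //.
by have := expR_ge1Dx (x / 2); lra.
Qed.

(** * Union bound and choice of constants *)

(** A union bound over three failures: finished by round [t0.+1], unfinished at round [t1.+1], or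
    two candidates left in an unfinished state at [t0.+1]. *)
Lemma election_failure_bound (R : realType) (k : nat) (rho : R) (rho01 : 0 < rho < 1)
    (S : {fset node}) (lab : labelling S) N t0 t1 (lo hi : R) :
  (0 < k)%N -> connected_structure S -> (1 < #|` S|)%N ->
  lo <= t0.+1%:R -> t1.+1%:R <= hi -> (t0 <= t1)%N -> (t1 < N)%N ->
  1 - ((1 - rho ^+ (2 * t0.+1)) ^+ #|` S| + #|` S|%:R * rho ^+ t1
       + #|` S|%:R ^+ 2 * (4 / 3 * (3 / 4) ^+ t0)) <=
  prob lab (elects_within (A := leader_protocol k rho01) (N := N) lo hi).
Proof.
move=> k0 Sc S1 lo0 hi1 t01 t1N.
have t0N : (t0 < N)%N := leq_ltn_trans t01 t1N.
pose config := {ffun S -> outcome (memory (leader_protocol k rho01)) k}.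
pose f0 (s : {ffun S -> amem}) : R := (finished s)%:R.
pose f1 (s : {ffun S -> amem}) : R := (~~ finished s)%:R.
pose f2 (p : S * S) (s : {ffun S -> amem}) : R :=
  [&& ~~ finished s, cand (s p.1) & cand (s p.2)]%:R.
have sv := start_valid Sc.
have E0 := run_expect rho01 lab Sc S1 k0 f0 t0N.
have E1 := run_expect rho01 lab Sc S1 k0 f1 t1N.
have E2 p := run_expect rho01 lab Sc S1 k0 (f2 p) t0N.
have B0 := finished_bound rho01 t0.+1 sv.
have B1 := unfinished_bound rho01 t1 sv.
have B2 p (hp : p.1 != p.2) := rivals_bound rho01 t0 hp sv.
set bad := (X in 1 - X).
have : 1 <= prob lab (elects_within (A := leader_protocol k rho01) (N := N) lo hi) + bad; last by lra.
rewrite -[leLHS](run_sum1 rho01 lab Sc S1 k0 N).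
(* On each run of nonzero probability, success or one of the failure indicators is 1. *)
have step : \sum_(w : N.-tuple config) run_prob lab w <= \sum_(w : N.-tuple config)
  run_prob lab w * ((elects_within lo hi w)%:R
   + f0 (mem_of (config_at w t0.+1)) + f1 (mem_of (config_at w t1.+1))
   + \sum_(p : S * S | p.1 != p.2) f2 p (mem_of (config_at w t0.+1))).
  apply: ler_sum => w _; have [->|w0] := eqVneq (run_prob lab w) 0.
    by rewrite mul0r.
  rewrite -[leLHS]mulr1 ler_wpM2l ?run_prob_ge0 //.
  have s0 : 0 <= \sum_(p : S * S | p.1 != p.2) f2 p (mem_of (config_at w t0.+1)).
    by apply: sumr_ge0.
  rewrite /f0 /f1 in s0 *.
  case: (boolP (finished (mem_of (config_at w t0.+1)))) => /= h0.
    by move: s0; case: (elects_within _ _ _); case: (finished _) => /=; lra.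
  case: (boolP (finished (mem_of (config_at w t1.+1)))) => /= h1; last first.
    by move: s0; case: (elects_within _ _ _) => /=; lra.
  case: (boolP [exists p : S * S, (p.1 != p.2) &&
     (cand (mem_of (config_at w t0.+1) p.1) &&
      cand (mem_of (config_at w t0.+1) p.2))]).
    case/existsP => p /andP[pp cp].
    rewrite (bigD1 p) //= {1}/f2 h0 cp /=.
    set r := \sum_(_ | _) _; have r0 : 0 <= r by apply: sumr_ge0.
    by case: (elects_within _ _ _) => /=; lra.
  move=> /existsPn hu.
  have -> : elects_within lo hi w.
    apply: (elects_within_run Sc S1 k0 w0 lo0 hi1 t1N) => // u v uv.
    by have := hu (u, v); rewrite /= uv.
  by move: s0 => /=; lra.
apply: (le_trans step).
under eq_bigr do rewrite !mulrDr; rewrite !big_split /= E0 E1 -!addrA.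
rewrite lerD //.
  rewrite /prob [leRHS]big_mkcond /= ler_sum // => w _.
  by case: (elects_within _ _ _) => /=; rewrite ?mulr1 ?mulr0.
rewrite /bad -!addrA lerD //; last rewrite lerD //.
- apply: le_trans B0 _; under eq_bigr do rewrite ffunE /=.
  by rewrite prodr_const -cardfE.
- by rewrite cardfE; apply: B1 => v; rewrite ffunE.
- under eq_bigr do rewrite mulr_sumr.
  rewrite exchange_big /=.
  have c0 : 0 <= 4 / 3 * (3 / 4 : R) ^+ t0.
    by rewrite mulr_ge0 ?exprn_ge0 //; lra.
  (* Counting all ordered pairs gives the factor [#|S|] squared. *)
  apply: (@le_trans _ _ (\sum_(p : S * S) 4 / 3 * (3 / 4) ^+ t0)).
    rewrite [leLHS]big_mkcond ler_sum // => p _; case: ifP => // hp.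
    by rewrite E2; apply: B2.
  by rewrite sumr_const card_prod -cardfE -[leLHS]mulr_natl natrM expr2.
Qed.

Theorem theorem1p1 (R : realType) (k : nat) (k_gt0 : (0 < k)%N)
    (c : R) (c_gt0 : 0 < c) :
  exists (A : protocol R k) (a b : R),
    [/\ global_circuit_only A, irrevocable A, 0 < a, 0 < b &
        forall (n : nat) (S : {fset node}) (lab : labelling S) (N : nat),
          connected_structure S -> #|` S| = n -> b * ln n%:R <= N%:R ->
          1 - (n%:R `^ c)^-1 <=
          prob lab (elects_within (A := A) (S := S) (N := N)
                      (a * ln n%:R) (b * ln n%:R))].
Proof.
have l0 : 0 < ln (4 / 3 : R) by apply: ln_gt0; lra.
have d0 : 0 < ln (2 : R) by apply: ln_gt0; lra.
(* Each failure term is held to order [n ^ -(c + 3)]; the spare factor [n ^ 3] absorbs their sum. *)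
have M0 : 0 < c + 3 by lra.
have [eta eta0 stopped] := all_stopped_bound M0.
have quotient (y z : R) : 0 < y -> 0 < z -> exists2 q, 0 < q & q * z = y.
  by move=> y0 z0; exists (y / z); rewrite ?divr_gt0 ?divfK ?gt_eqF.
(* After [L * ln n] rounds a pair survives with probability of order [n ^ -(c + 5)], which leaves
   room for [n ^ 2] pairs. *)
have [||L L0 LE] := quotient (c + 5) (ln (4 / 3)); [lra|by []|].
(* For [n >= 2] this gives [e * ln n >= 2], enough to absorb a rounding up and a successor. *)
have [||e e0 eE] := quotient 2 (ln 2); [lra|by []|].
(* With [rho = expR (- delta)], a clock outlasts [(L + e) * ln n] rounds with probability at least
   [n ^ -eta]. *)
have [||delta delta0 deltaE] := quotient eta (2 * (L + e)); [by []|lra|].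
(* [B * ln n] rounds bring [rho ^+ t1] down to [n ^ -(c + 4)], one power being spent on the [n]
   clocks. *)
have [||B B0 BE] := quotient (c + 4) delta; [lra|by []|].
have rho01 : 0 < expR (- delta) < 1.
  by rewrite expR_gt0 expR_lt1 oppr_lt0.
exists (leader_protocol k rho01), L, (L + e + B + e); split => //.
- exact: leader_protocol_global.
- exact: leader_protocol_irrevocable.
- by rewrite !addr_gt0.
move=> n S lab N Sc Sn bN.
have : (0 < n)%N by rewrite -Sn cardfs_gt0; apply: Sc.1.
(* For [n = 1] the claimed lower bound is 0. *)
rewrite leq_eqVlt => /orP[/eqP n1|n1].
  rewrite -n1 powR1 invr1 subrr; apply: sumr_ge0 => w _.
  exact: run_prob_ge0.
have n0 := ltnW n1.
have x2 : ln 2 <= ln n%:R :> R by rewrite ler_ln ?posrE ?ltr0n ?ler_nat.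
have nE : n%:R = expR (ln n%:R) :> R by rewrite lnK // posrE ltr0n.
have stopped_n := stopped n n0.
have -> : (n%:R `^ c)^-1 = expR (- (c * ln n%:R)).
  by rewrite /powR pnatr_eq0 gtn_eqF // -expRN.
move: (ln n%:R) x2 nE stopped_n bN => x x2 nE stopped_n bN {stopped quotient}.
have x0 : 0 < x := lt_le_trans d0 x2.
have ex2 : 2 <= e * x by rewrite -eE ler_wpM2l // ltW.
have Lx0 : 0 < L * x := mulr_gt0 L0 x0.
have Bx0 : 0 < B * x := mulr_gt0 B0 x0.
have ceiling (y : R) : 0 <= y -> exists t : nat, y <= t%:R <= y + 1.
  move=> y0; have /andP[lo hi] := truncn_itv y0; exists (Num.truncn y).+1.
  by rewrite (ltW hi) -natr1 lerD2r.
have [t0 /andP[t0l t0u]] := ceiling _ (ltW Lx0).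
have [|t1 /andP[t1l t1u]] := ceiling (L * x + e * x + B * x); first lra.
have t01 : (t0 <= t1)%N by rewrite -(ler_nat R); lra.
have bx : t1.+1%:R <= (L + e + B + e) * x by rewrite !mulrDl -natr1; lra.
have t1N : (t1 < N)%N by rewrite -(ler_nat R); apply: le_trans bN.
have lo : L * x <= t0.+1%:R by rewrite -natr1; lra.
have S1 : (1 < #|` S|)%N by rewrite Sn.
apply: le_trans (election_failure_bound rho01 lab k_gt0 Sc S1 lo bx t01 t1N).
rewrite Sn lerD2l lerN2.
have early : (1 - expR (- delta) ^+ (2 * t0.+1)) ^+ n <= expR (- ((c + 3) * x)).
  apply: le_trans stopped_n; apply: lerXn2r.
  - by rewrite nnegrE subr_ge0 -expRM_natl expR_le1 mulrN oppr_le0 mulr_ge0 // ltW.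
  - by rewrite nnegrE subr_ge0 expR_le1 oppr_le0 mulr_ge0 // ltW.
  rewrite lerD2l lerN2 -expRM_natl ler_expR mulrN lerN2 natrM.
  have -> : eta * x = 2 * (L * x + e * x) * delta by rewrite -deltaE; ring.
  rewrite ler_wpM2r ?(ltW delta0) // ler_wpM2l //.
  by rewrite -natr1; lra.
have late : n%:R * expR (- delta) ^+ t1 <= expR (- ((c + 3) * x)).
  rewrite nE -expRM_natl -expRD ler_expR.
  have : B * x * delta <= t1%:R * delta.
    by rewrite ler_wpM2r ?(ltW delta0) //; lra.
  have -> : B * x * delta = (c + 4) * x by rewrite -BE mulrAC.
  by rewrite mulrN !mulrDl; lra.
have rivals : n%:R ^+ 2 * (4 / 3 * (3 / 4) ^+ t0) <= 4 / 3 * expR (- ((c + 3) * x)).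
  rewrite mulrCA ler_wpM2l ?divr_ge0 //.
  have -> : 3 / 4 = expR (- ln (4 / 3)) :> R.
    by rewrite expRN lnK ?posrE ?divr_gt0 // invf_div.
  rewrite nE -!expRM_natl -expRD ler_expR.
  have : L * x * ln (4 / 3) <= t0%:R * ln (4 / 3).
    by rewrite ler_wpM2r ?(ltW l0).
  have -> : L * x * ln (4 / 3) = (c + 5) * x by rewrite -LE mulrAC.
  by rewrite mulrN !mulrDl; lra.
have -> : expR (- (c * x)) = expR x ^+ 3 * expR (- ((c + 3) * x)).
  by rewrite -expRM_natl -expRD; congr expR; ring.
have z0 := expR_gt0 (- ((c + 3) * x)).
(* As [n >= 2], the factor [n ^ 3] exceeds 1 + 1 + 4/3, the sum of the three coefficients. *)
have eight : 8 <= expR x ^+ 3.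
  by rewrite -nE -natrX ler_nat (leq_trans (_ : 8 <= 2 ^ 3)%N) // leq_exp2r.
have := ler_wpM2r (ltW z0) eight.
move: early late rivals z0; move: (expR _) (_ ^+ 3 * _) => z u.
move: ((1 - _) ^+ _) (_ * _ ^+ t1) (_ ^+ 2 * _) => p q r.
by lra.
Qed.
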